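(* Let $a,b$ be positive integers with $a$ even and $a+b\geq 4$, and let $\Gamma$ be the graph obtained from the complete graph $K_{a+b}$ by deleting the edges of a matching covering exactly $a$ vertices. Then the eigenvalues of (the adjacency matrix of) $\Gamma$ are as follows: (1) the roots of the quadratic $x^2-(a+b-3)x-(a+2b-2)$, each with multiplicity $1$; (2) $0$, with multiplicity $a/2$; (3) $-2$, with multiplicity $(a/2)-1$; (4) $-1$, with multiplicity $b-1$.
   Context: A listed eigenvalue with multiplicity $0$ is understood not to occur through that item. *)

(* Defs.v *)
From mathcomp Require Import all_boot all_order all_algebra.

Set Implicit Arguments.
Unset Strict Implicit.
Unset Printing Implicit Defensive.

Import GRing.Theory.
Local Open Scope ring_scope.

(* Simple graphs on T are irreflexive symmetric relations; the edge joining x  *)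
(* and y is the unordered pair [set x; y].                                     *)

Definition complete_graph (T : finType) : rel T := fun x y => x != y.

Definition edge_set (T : finType) (e : rel T) : {set {set T}} :=
  [set [set p.1; p.2] | p : T * T & e p.1 p.2].

Definition matching (T : finType) (e : rel T) (M : {set {set T}}) : bool :=
  (M \subset edge_set e) && trivIset M.

Definition delete_edges (T : finType) (e : rel T) (M : {set {set T}}) : rel T :=
  fun x y => e x y && ([set x; y] \notin M).

Definition adjacency_matrix (R : pzRingType) (n : nat) (e : rel 'I_n) :
  'M[R]_n := \matrix_(i, j) (e i j)%:R.

(* Algebraic multiplicity; it is 0 when x is not an eigenvalue of A.           *)
Definition eigen_mult (F : fieldType) (n : nat) (A : 'M[F]_n) (x : F) : nat :=
  mup x (char_poly A).

(* Main.v *)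
Require Import Defs.
From mathcomp Require Import all_boot all_order all_algebra.
From mathcomp Require Import ring lra zify.

Import Order.TTheory GRing.Theory Num.Theory.
Local Open Scope ring_scope.

(** Let P be the adjacency matrix of the deleted matching, so that the adjacency
    matrix of the graph is A = J - I - P, with J the all-ones matrix.  Put
    y = X + 1; then X I - A = (y I + P) - J is a rank one perturbation of the
    matrix B = y I + P.

    The determinant of B is found by triangularization.  Split P as N + N^T with
    N strictly upper triangular.  Since an edge of a matching meets no other
    edge, N^2 = 0 and N^T N is diagonal, so B (y I - N) = y^2 I + y N^T - N^T N
    is lower triangular; this gives det B = (y^2 - 1)^(a/2) y^b
    ([det_shifted_matching]).

    The perturbation is handled by a division-free form of the matrix
    determinant lemma ([det_rank1_update]).  The vector u with entry y at the
    covered vertices and y + 1 at the others satisfies B u = y (y + 1) 1, whence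
      y (y + 1) char_poly A = det B (y (y + 1) - a y - b (y + 1)).
    The last factor is the quadratic of the statement, and cancelling y (y + 1)
    yields
      char_poly A = X^(a/2) (X + 2)^(a/2 - 1) (X + 1)^(b - 1) q
    ([char_poly_delete_matching]).  The discriminant of q is positive, and q does
    not vanish at 0, -1 and -2, because it takes there the values
    -(a + 2 b - 2), -b and a. *)

(** * A determinant lemma *)

(** If [B u = d c], the determinant of the bordered matrix [B c; w 1] can be
    computed by clearing either its bottom left or its top right block. *)
Lemma det_rank1_update (R : comNzRingType) (n : nat) (B : 'M[R]_n)
    (c u : 'cV[R]_n) (w : 'rV[R]_n) (d : R) :
  B *m u = d *: c ->
  d * \det (B - c *m w) = \det B * (d - (w *m u) 0 0).
Proof.
move=> Bu; pose D := block_mx B c w (1%:M : 'M_1).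
have detD : \det D = \det (B - c *m w).
  have E : D *m block_mx 1%:M 0 (- w) 1%:M = block_mx (B - c *m w) c 0 1%:M.
    rewrite mulmx_block !mulmx1 !mulmx0 !mulmxN !mul1mx !add0r.
    by rewrite subrr.
  move/(congr1 determinant): E.
  by rewrite det_mulmx det_lblock det_ublock !det1 !mulr1.
have E : D *m block_mx 1%:M (- u) 0 d%:M = block_mx B 0 w (d%:M - w *m u).
  rewrite mulmx_block !mulmx1 !mulmx0 !mulmxN !mul1mx !addr0 Bu.
  by rewrite mul_mx_scalar addNr [- _ + _]addrC.
move/(congr1 determinant): E; rewrite det_mulmx det_ublock det_lblock.
by rewrite det1 mul1r detD !det_mx11 !mxE mulr1n mulrC => ->.
Qed.

Lemma card_setC_ord (n : nat) (S : {set 'I_n}) : #|~: S| = (n - #|S|)%N.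
Proof. by have := cardsC S; rewrite card_ord; lia. Qed.

(** * Relations in which every vertex has at most one neighbour *)

Section MatchingRelation.

Variables (n : nat) (e : rel 'I_n).
Hypothesis e_sym : symmetric e.
Hypothesis e_irr : irreflexive e.
Hypothesis e_fun : forall i j k, e i j -> e i k -> j = k.

(** The vertices incident to an edge, and the larger endpoints of the edges. *)
Definition covered : {set 'I_n} := [set i | [exists j, e i j]].
Definition larger : {set 'I_n} := [set i : 'I_n | [exists j : 'I_n, (j < i)%N && e i j]].

Lemma sum_neighbours (R : pzRingType) (f : 'I_n -> R) i k :
  e i k -> \sum_j (e i j)%:R * f j = f k.
Proof.
move=> eik; rewrite (bigD1 k) //= eik mul1r big1 ?addr0 // => j jk.
case eij: (e i j); last by rewrite mul0r.
by case/eqP: jk; apply: e_fun eij eik.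
Qed.

Lemma sum_no_neighbour (R : pzRingType) (f : 'I_n -> R) i :
  i \notin covered -> \sum_j (e i j)%:R * f j = 0.
Proof.
rewrite inE => /existsPn H; apply: big1 => j _.
by rewrite (negbTE (H j)) mul0r.
Qed.

Lemma sum_larger (i : 'I_n) :
  (\sum_(j < n) ((j < i)%N && e i j : nat) = (i \in larger))%N.
Proof.
rewrite inE; case: existsP => [[k /andP[ki eik]]|H].
  rewrite (bigD1 k) //= ki eik big1 // => j jk.
  case eij: (e i j); last by rewrite andbF.
  by case/eqP: jk; apply: e_fun eij eik.
by apply: big1 => j _; case: (boolP (_ && _)) => // h; case: H; exists j.
Qed.

Lemma sum_covered (i : 'I_n) : (\sum_(j < n) (e i j : nat) = (i \in covered))%N.
Proof.
rewrite inE; case: existsP => [[k eik]|H].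
  rewrite (bigD1 k) //= eik big1 // => j jk.
  by case eij: (e i j) => //; case/eqP: jk; apply: e_fun eij eik.
by apply: big1 => j _; case eij: (e i j) => //; case: H; exists j.
Qed.

(** Each edge has exactly one larger and one smaller endpoint. *)
Lemma card_covered : #|covered| = (#|larger|).*2.
Proof.
have cardE (S : {set 'I_n}) : #|S| = (\sum_(i < n) (i \in S : nat))%N.
  by rewrite -sum1_card big_mkcond; apply: eq_bigr => i _; case: (i \in S).
have countL : #|larger|
    = (\sum_(i < n) \sum_(j < n) ((j < i)%N && e i j : nat))%N.
  by rewrite cardE; apply: eq_bigr => i _; rewrite sum_larger.
(* The same pairs, grouped by their smaller instead of their larger element. *)
have countS : #|larger|
    = (\sum_(i < n) \sum_(j < n) ((i < j)%N && e j i : nat))%N.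
  by rewrite countL exchange_big.
rewrite -addnn {1}countL countS cardE -big_split /=.
under eq_bigr => i _ do rewrite -sum_covered.
apply: eq_bigr => i _; rewrite -big_split /=; apply: eq_bigr => j _.
rewrite [e j i]e_sym; case eij: (e i j); last by rewrite !andbF.
by case: ltngtP => // /ord_inj ij; rewrite ij e_irr in eij.
Qed.

(** With [P] the adjacency matrix of [e] and [N] its strictly upper part,
    multiplying [y I + P] by [y I - N], of determinant [y ^+ n], gives a lower
    triangular matrix with diagonal entries [y ^+ 2 - 1] at the larger endpoints
    and [y ^+ 2] elsewhere. *)
Lemma det_shifted_matching (R : idomainType) (y : R) : y != 0 ->
  \det (y%:M + adjacency_matrix R e)
    = (y ^+ 2 - 1) ^+ #|larger| * y ^+ (n - #|covered|).
Proof.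
move=> y0.
pose N : 'M[R]_n := \matrix_(i, j) ((i < j)%N && e i j)%:R.
have PE : adjacency_matrix R e = N + N^T.
  apply/matrixP => i j; rewrite !mxE [e j i]e_sym.
  case eij: (e i j); last by rewrite !andbF addr0.
  case: ltngtP => [||/ord_inj ij]; rewrite ?addr0 ?add0r //.
  by rewrite ij e_irr in eij.
have NN : N *m N = 0.
  apply/matrixP => i k; rewrite !mxE big1 // => j _; rewrite !mxE -natrM.
  case: (boolP (_ && _)) => [/andP[ij eij]|]; last by rewrite mul0n.
  case: (boolP (_ && _)) => [/andP[jk ejk]|]; last by rewrite muln0.
  rewrite e_sym in eij; have ik := e_fun _ _ _ eij ejk.
  by rewrite -ik ltnNge ltnW in jk.
have NTN i k : (N^T *m N) i k = ((i == k) && (i \in larger))%:R.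
  rewrite !mxE; case: eqP => [<-|ik] /=.
    rewrite -sum_larger natr_sum; apply: eq_bigr => j _.
    by rewrite !mxE e_sym -natrM mulnb andbb.
  apply: big1 => j _; rewrite !mxE -natrM.
  case: (boolP (_ && _)) => [/andP[_ eji]|]; last by rewrite mul0n.
  case: (boolP (_ && _)) => [/andP[_ ejk]|]; last by rewrite muln0.
  by case: ik; apply: e_fun eji ejk.
have E : (y%:M + adjacency_matrix R e) *m (y%:M - N)
         = (y ^+ 2)%:M + y *: N^T - N^T *m N.
  rewrite PE !mulmxDl !mulmxBr NN !mul_mx_scalar !mul_scalar_mx.
  rewrite expr2 subr0 -scale_scalar_mx.
  by apply/matrixP => i j; rewrite !mxE; ring.
have detN : \det (y%:M - N) = y ^+ n.
  rewrite -det_tr det_trig.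
    rewrite (eq_bigr (fun=> y)) ?prodr_const ?card_ord // => i _.
    by rewrite !mxE eqxx ltnn subr0.
  apply/is_trig_mxP => i j ij; rewrite !mxE.
  by rewrite -val_eqE /= gtn_eqF // ltnNge ltnW //= subr0.
have card_le : (#|larger|.*2 <= n)%N.
  by rewrite -card_covered -[X in (_ <= X)%N]card_ord max_card.
move/(congr1 determinant): E; rewrite det_mulmx detN.
have ME i k : ((y ^+ 2)%:M + y *: N^T - N^T *m N) i k
    = y ^+ 2 *+ (i == k) + y * ((k < i)%N && e k i)%:R
      - ((i == k) && (i \in larger))%:R.
  by rewrite -NTN mxE mxE [X in _ + X]mxE !mxE.
rewrite [in RHS]det_trig; last first.
  apply/is_trig_mxP => i j ij; rewrite ME -val_eqE /= ltn_eqF // [(j < i)%N]ltnNge ltnW //=.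
  by rewrite mulr0n mulr0 addr0 subr0.
rewrite (eq_bigr (fun i => if i \in larger then y ^+ 2 - 1 else y ^+ 2)).
  rewrite big_if /= !prodr_const => E.
  have yn0 : y ^+ n != 0 by rewrite expf_neq0.
  apply: (mulIf yn0); rewrite E -!mulrA -exprM -exprD; congr (_ * _ ^+ _).
  rewrite card_covered -addnn.
  have -> : #|[pred i | i \notin larger]| = (n - #|larger|)%N.
    by rewrite -card_setC_ord; apply: eq_card => i; rewrite in_setC.
  by lia.
move=> i _; rewrite ME eqxx ltnn /=.
by case: (i \in larger); rewrite ?mulr0 ?addr0 ?subr0.
Qed.

(** The vector [u] below solves [B *m u = (y * (y + 1)) *: 1], so that
    [det_rank1_update] applies with [d = y * (y + 1)]. *)
Lemma char_poly_complement_matching (R : idomainType) (y := 'X + 1 : {poly R}) :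
  y * (y + 1)
    * char_poly (adjacency_matrix R (fun i j => (i != j) && ~~ e i j))
  = (y ^+ 2 - 1) ^+ #|larger| * y ^+ (n - #|covered|)
    * (y * (y + 1) - #|covered|%:R * y - (n - #|covered|)%:R * (y + 1)).
Proof.
pose u : 'cV[{poly R}]_n := \col_i (y + (i \notin covered)%:R).
pose B : 'M[{poly R}]_n := y%:M + adjacency_matrix {poly R} e.
pose c : 'cV[{poly R}]_n := const_mx 1.
pose w : 'rV[{poly R}]_n := const_mx 1.
have y0 : y != 0 by rewrite -[y]/('X + 1%:P) -size_poly_eq0 size_XaddC.
have Bu : B *m u = (y * (y + 1)) *: c.
  apply/colP => i; rewrite mulmxDl mul_scalar_mx !mxE mulr1.
  under eq_bigr => j _ do rewrite !mxE.
  have [ci|nci] := boolP (i \in covered); last first.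
    by rewrite sum_no_neighbour // addr0.
  have /existsP[k eik] : [exists k, e i k] by rewrite inE in ci.
  have ck : k \in covered by rewrite inE; apply/existsP; exists i; rewrite e_sym.
  by rewrite (sum_neighbours _ _ _ k) // ck /=; ring.
have charE : char_poly (adjacency_matrix R (fun i j => (i != j) && ~~ e i j))
    = \det (B - c *m w).
  rewrite /char_poly; congr determinant; apply/matrixP => i j.
  rewrite !mxE big_ord1 !mxE /y; case: eqP => [<-|_] /=.
    by rewrite e_irr polyC0 mulr0n; ring.
  by case: (e i j) => /=; rewrite ?polyC0 ?polyC1; ring.
rewrite charE (det_rank1_update _ _ _ _ _ _ _ Bu) (det_shifted_matching _ _ y0).
congr (_ * _).
have -> : (w *m u) 0 0 = n%:R * y + (n - #|covered|)%:R.
  rewrite mxE; under eq_bigr => i _ do rewrite !mxE mul1r.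
  rewrite big_split /= sumr_const card_ord -[y *+ n]mulr_natl -natr_sum.
  rewrite -card_setC_ord -sum1_card [in RHS]big_mkcond /=.
  congr (_ + _ *+ _); apply: eq_bigr => i _.
  by rewrite in_setC; case: (_ \in _).
have /subnKC nE : (#|covered| <= n)%N.
  by rewrite -[X in (_ <= X)%N]card_ord max_card.
by rewrite -{1}nE natrD; ring.
Qed.

End MatchingRelation.

(** * The relation defined by a matching *)

(** Being joined by an edge of [M]. *)
Definition matched {T : finType} (M : {set {set T}}) : rel T :=
  fun x y => [set x; y] \in M.

Section Matched.

Variables (T : finType) (M : {set {set T}}).
Hypothesis M_matching : matching (@complete_graph T) M.

Lemma matched_sym : symmetric (matched M).
Proof. by move=> x y; rewrite /matched setUC. Qed.

Lemma mem_matchingP (B : {set T}) :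
  B \in M -> exists x y, x != y /\ B = [set x; y].
Proof.
case/andP: M_matching => /subsetP sM _ /sM /imsetP[[x y] + ->].
by rewrite inE /complete_graph /= => xy; exists x, y.
Qed.

Lemma matched_irr : irreflexive (matched M).
Proof.
move=> x; apply/negP => /mem_matchingP[u [v [uv E]]].
by move/(congr1 (fun B : {set T} => #|B|)): E; rewrite !cards2 eqxx uv.
Qed.

Lemma matched_fun x y z : matched M x y -> matched M x z -> y = z.
Proof.
move=> xy xz; case/andP: M_matching => _ /trivIsetP tM.
have [E|ne] := eqVneq [set x; y] [set x; z].
  have : y \in [set x; z] by rewrite -E set22.
  by case/set2P => // yx; move: xy; rewrite yx matched_irr.
have /disjointFr/(_ (set21 x y)) := tM _ _ xy xz ne.
by rewrite set21.
Qed.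

Lemma mem_cover_matched x : (x \in cover M) = [exists y, matched M x y].
Proof.
apply/bigcupP/existsP => [[B BM]|[y xy]]; last by exists [set x; y]; rewrite ?set21.
have [u [v [_ E]]] := mem_matchingP _ BM; move: BM; rewrite E => BM.
case/set2P => ->; first by exists v.
by exists u; rewrite matched_sym.
Qed.

End Matched.

(** * The characteristic polynomial and its roots *)

(** The factor of the characteristic polynomial that the rank one perturbation
    contributes. *)
Definition deleted_matching_quadratic {R : comNzRingType} (a b : nat) : {poly R} :=
  'X^2 - (a%:R + b%:R - 3%:R)%:P * 'X - (a%:R + 2%:R * b%:R - 2%:R)%:P.

Lemma char_poly_delete_matching (R : idomainType) (a b : nat)
    (M : {set {set 'I_(a + b)}}) :
  (0 < a)%N -> (0 < b)%N ->
  matching (@complete_graph 'I_(a + b)) M -> #|cover M| = a ->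
  char_poly (adjacency_matrix R (delete_edges (@complete_graph 'I_(a + b)) M))
  = 'X ^+ a./2 * ('X - (- 2%:R)%:P) ^+ (a./2 - 1) * ('X - (- 1)%:P) ^+ (b - 1)
    * deleted_matching_quadratic a b.
Proof.
move=> a_gt0 b_gt0 HM covM.
have e_sym := matched_sym _ M; have e_irr := matched_irr _ _ HM.
have e_fun := matched_fun _ _ HM.
have cc : #|covered _ (matched M)| = a.
  by apply: etrans covM; apply: eq_card => x; rewrite mem_cover_matched // inE.
have a2m := card_covered _ _ e_sym e_irr e_fun; rewrite cc in a2m.
have E : ('X + 1) * ('X + 1 + 1) * char_poly (adjacency_matrix R
    (delete_edges (@complete_graph 'I_(a + b)) M)) = _
  := char_poly_complement_matching _ _ e_sym e_irr e_fun R.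
rewrite cc addKn in E.
move: #|_| (char_poly _) a2m E => m p a2m; rewrite a2m doubleK => E.
have m_gt0 : (0 < m)%N by move: a_gt0; rewrite a2m double_gt0.
have y0 : ('X + 1 : {poly R}) != 0.
  by rewrite -[_ + _]/('X + 1%:P) -size_poly_eq0 size_XaddC.
have y1 : ('X + 1 + 1 : {poly R}) != 0.
  by rewrite -addrA -[1 + 1]/(1%:P + 1%:P) -polyCD -size_poly_eq0 size_XaddC.
(* Cancel y (y + 1), where y = X + 1 and y ^ 2 - 1 = X (y + 1). *)
apply: (mulfI (mulf_neq0 y0 y1)); rewrite [LHS]E.
rewrite -{1}(prednK m_gt0) -{1}(prednK b_gt0) -!subn1.
rewrite -[in 'X ^+ m](prednK m_gt0) -subn1.
have -> : ('X + 1) ^+ 2 - 1 = 'X * ('X + 1 + 1) :> {poly R} by ring.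
rewrite !exprS exprMn /deleted_matching_quadratic.
rewrite !polyCB !polyCN !polyCD polyCM !polyC_natr.
rewrite -mul2n natrM.
have -> : 'X - (- 2%:R) = 'X + 1 + 1 :> {poly R} by ring.
have -> : 'X - (- 1%:P) = 'X + 1 :> {poly R} by ring.
by ring.
Qed.

Lemma quadratic_factor (R : rcfType) (s t : R) : 0 < t ->
  exists theta1 theta2 : R, theta1 != theta2 /\
    'X^2 - s%:P * 'X - t%:P = ('X - theta1%:P) * ('X - theta2%:P).
Proof.
move=> t0; pose r := Num.sqrt (s ^+ 2 + 4%:R * t).
have d0 : 0 < s ^+ 2 + 4%:R * t by nra.
have r0 : 0 < r by rewrite sqrtr_gt0.
have r2 : r ^+ 2 = s ^+ 2 + 4%:R * t by rewrite sqr_sqrtr // ltW.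
exists ((s + r) / 2%:R), ((s - r) / 2%:R).
move: r r0 r2 => r r0 r2; split; first by apply/eqP; lra.
set x := (s + r) / _; set z := (s - r) / _.
have -> : s = x + z by rewrite /x /z; field.
have -> : t = - (x * z).
  have -> : t = (r ^+ 2 - s ^+ 2) / 4%:R by rewrite r2; field.
  by rewrite /x /z; field.
by rewrite polyCN; move: x z => x z; rewrite polyCD polyCM; ring.
Qed.

Theorem mainTheorem8 (R : rcfType) (a b : nat)
  (a_gt0 : (0 < a)%N) (b_gt0 : (0 < b)%N) (a_even : ~~ odd a)
  (ab_ge4 : (4 <= a + b)%N)
  (M : {set {set 'I_(a + b)}})
  (M_matching : matching (@complete_graph 'I_(a + b)) M)
  (M_covers : #|cover M| = a) :
  let A : 'M[R]_(a + b) :=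
    adjacency_matrix R (delete_edges (@complete_graph 'I_(a + b)) M) in
  let q : {poly R} :=
    'X^2 - (a%:R + b%:R - 3%:R)%:P * 'X - (a%:R + 2%:R * b%:R - 2%:R)%:P in
  exists theta1 theta2 : R,
    [/\ theta1 != theta2,
        q = ('X - theta1%:P) * ('X - theta2%:P),
        forall x : R, eigenvalue A x <->
          [\/ x = theta1 \/ x = theta2,
              x = 0,
              x = - 2%:R /\ (0 < a./2 - 1)%N
            | x = - 1 /\ (0 < b - 1)%N]
      & [/\ eigen_mult A theta1 = 1%N /\ eigen_mult A theta2 = 1%N,
            eigen_mult A 0 = a./2,
            eigen_mult A (- 2%:R) = (a./2 - 1)%N
          & eigen_mult A (- 1) = (b - 1)%N]].
Proof.
move=> A q.
have a_ge2 : (2 <= a)%N by lia.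
have t_gt0 : 0 < a%:R + 2%:R * b%:R - 2%:R :> R.
  by rewrite -natrM -natrD subr_gt0 ltr_nat; lia.
have [th1 [th2 [th12 qE]]] := quadratic_factor R (a%:R + b%:R - 3%:R) _ t_gt0.
exists th1, th2.
(* The eigenvalues, listed with multiplicity. *)
pose s := th1 :: th2 ::
  nseq a./2 0 ++ nseq (a./2 - 1) (- 2%:R) ++ nseq (b - 1) (- 1).
have pE : char_poly A = \prod_(x <- s) ('X - x%:P).
  rewrite /A char_poly_delete_matching // /deleted_matching_quadratic qE.
  rewrite !big_cons !big_cat !big_nseq !iter_mulr_1 subr0 /=.
  by rewrite mulrC !mulrA.
have multE x : eigen_mult A x = count_mem x s.
  by rewrite /eigen_mult pE mu_prod_XsubC.
have qval x : (x - th1) * (x - th2)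
    = x ^+ 2 - (a%:R + b%:R - 3%:R) * x - (a%:R + 2%:R * b%:R - 2%:R).
  by have := congr1 (horner^~ x) qE; rewrite !hornerE => ->.
have a_pos : 0 < a%:R :> R by rewrite ltr0n.
have b_pos : 0 < b%:R :> R by rewrite ltr0n.
have nroot x :
    (x - th1) * (x - th2) != 0 -> (x == th1 = false) * (x == th2 = false).
  by rewrite mulf_eq0 !subr_eq0 negb_or => /andP[/negbTE -> /negbTE ->].
(* The values of q at 0, -1 and -2 are -(a + 2 b - 2), -b and a. *)
have n0 : (0 - th1) * (0 - th2) != 0 by rewrite qval; apply/eqP; lra.
have n1 : (- 1 - th1) * (- 1 - th2) != 0 by rewrite qval; apply/eqP; lra.
have n2 : (- 2%:R - th1) * (- 2%:R - th2) != 0 by rewrite qval; apply/eqP; lra.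
have e02 : (0 == - 2%:R :> R) = false by apply/eqP; lra.
have e01 : (0 == - 1 :> R) = false by apply/eqP; lra.
have e12 : (- 1 == - 2%:R :> R) = false by apply/eqP; lra.
have [/nroot n0' /nroot n1'] := (n0, n1); have n2' := nroot _ n2.
have cE x : count_mem x s = ((th1 == x) + (th2 == x) + ((0 : R)%R == x) * a./2
    + ((- 2%:R)%R == x) * (a./2 - 1) + ((- 1)%R == x) * (b - 1))%N.
  by rewrite /= !count_cat !count_nseq /= !addnA.
split=> //.
- move=> x; rewrite eigenvalue_root_char pE root_prod_XsubC.
  rewrite !inE !mem_cat !mem_nseq; split.
    case/or3P=> [/eqP->|/eqP->|/or3P[]/andP[h /eqP->]].
    + by apply: Or41; left.
    + by apply: Or41; right.
    + exact: Or42.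
    + exact: Or43.
    + exact: Or44.
  case=> [[]->|->|[-> h]|[-> h]]; rewrite ?eqxx ?h ?andbT ?orbT //.
  by rewrite half_gt0 a_ge2 !orbT.
- rewrite !multE !cE !eqxx !n0' !n1' !n2' [th2 == th1]eq_sym (negbTE th12).
  rewrite ![th1 == _]eq_sym ![th2 == _]eq_sym !n0' !n1' !n2'.
  rewrite [- 2%:R == 0]eq_sym [- 1 == 0]eq_sym [- 2%:R == - 1]eq_sym e02 e01 e12.
  by rewrite !mul0n !mul1n !addn0 !add0n.
Qed.
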